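(* Deciding whether a finite set of stochastic matrices is a consensus set is algorithmically decidable. That is, there is an algorithm which, given any finite set $\mathcal{P}$ of stochastic matrices of the same size $n\times n$ ($n$ arbitrary), halts and correctly determines whether $\mathcal{P}$ is a consensus set.
   Context: A stochastic matrix is a square matrix with nonnegative real entries each of whose rows sums to $1$. A set $\mathcal{P}$ of stochastic $n\times n$ matrices is a consensus set if for every sequence $P(1), P(2), \ldots$ of matrices belonging to $\mathcal{P}$ and every initial state $x(0)\in\mathbb{R}^n$, the sequence defined by $x(t) = P(t)x(t-1)$, $t=1,2,\ldots$, satisfies $\lim_{t\to\infty} x(t) = \alpha \mathbf{1}$ for some scalar $\alpha$ (which may depend on $x(0)$ and on the matrix sequence), where $\mathbf{1}$ is the vector of all ones. As usual for decision problems, input matrices are given explicitly by a finite encoding (e.g. rational entries). *)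

(* Defs.v *)
From mathcomp Require Import all_boot all_order all_algebra.
From mathcomp Require Import all_classical all_reals all_analysis.
Set Implicit Arguments.
Unset Strict Implicit.
Unset Printing Implicit Defensive.
Import Order.TTheory GRing.Theory Num.Theory.
Import numFieldNormedType.Exports.
Local Open Scope classical_set_scope.
Local Open Scope ring_scope.

Definition stochastic (K : numDomainType) (n : nat) (A : 'M[K]_n) : Prop :=
  (forall i j, 0 <= A i j) /\ (forall i, \sum_j A i j = 1).

(* The factors are [P 1], [P 2], ...; the value [P 0] is never used. *)
Fixpoint trajectory (R : pzRingType) (n : nat) (P : nat -> 'M[R]_n)
    (x0 : 'cV[R]_n) (t : nat) : 'cV[R]_n :=
  if t is s.+1 then P s.+1 *m trajectory P x0 s else x0.

Definition consensus_set (R : realType) (n : nat) (Ps : set 'M[R]_n) : Prop :=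
  forall (P : nat -> 'M[R]_n) (x0 : 'cV[R]_n),
    (forall t, (0 < t)%N -> Ps (P t)) ->
    exists alpha : R,
      trajectory P x0 t @[t --> \oo] --> (const_mx alpha : 'cV[R]_n).

(* Definability in Rocq is no substitute for computability here: with the
   classical axioms in use, every predicate has a boolean decision function.
   Algorithms are therefore programs for mu-recursive functions;
   [recfun k] is the syntax of the partial recursive functions of arity [k]. *)
Inductive recfun : nat -> Type :=
| Rzero k : recfun k
| Rsucc : recfun 1
| Rproj k (i : 'I_k) : recfun k
| Rcomp k m (f : recfun m) (g : 'I_m -> recfun k) : recfun k
| Rprec k (f : recfun k) (g : recfun k.+2) : recfun k.+1
| Rmu k (f : recfun k.+1) : recfun k.

Fixpoint prec_eval (base : nat -> Prop) (step : nat -> nat -> nat -> Prop)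
    (n y : nat) : Prop :=
  if n is m.+1 then exists2 r, prec_eval base step m r & step m r y
  else base y.

(* [rec_eval f v y]: the computation of [f] on [v] halts with output [y].
   The recursion variable of [Rprec] and the search variable of [Rmu] come
   first; in [Rmu] all the values below the result must be defined. *)
Fixpoint rec_eval (k : nat) (f : recfun k) : k.-tuple nat -> nat -> Prop :=
  match f in recfun k return k.-tuple nat -> nat -> Prop with
  | Rzero _ => fun _ y => y = 0%N
  | Rsucc => fun v y => y = (thead v).+1
  | Rproj _ i => fun v y => y = tnth v i
  | Rcomp _ m f g => fun v y =>
      exists2 w : m.-tuple nat,
        (forall i, rec_eval (g i) v (tnth w i)) & rec_eval f w y
  | Rprec _ f g => fun v y =>
      prec_eval (rec_eval f [tuple of behead v])
        (fun i r => rec_eval g [tuple of i :: r :: behead v]) (thead v) y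
  | Rmu _ f => fun v y =>
      rec_eval f [tuple of y :: v] 0 /\
      (forall z, (z < y)%N -> exists u, rec_eval f [tuple of z :: v] u.+1)
  end.

Lemma rec_eval_fun (k : nat) (f : recfun k) (v : k.-tuple nat) (y z : nat) :
  rec_eval f v y -> rec_eval f v z -> y = z.
Proof.
elim: f v y z => {k} [k|/=|k i|k m f IHf g IHg|k f IHf g IHg|k f IHf] v y z /=.
- by move=> -> ->.
- by move=> -> ->.
- by move=> -> ->.
- move=> [w gw fw] [w' gw' fw'].
  have ww' : w = w' by apply: eq_from_tnth => i; exact: IHg (gw i) (gw' i).
  by rewrite -ww' in fw'; exact: IHf fw fw'.
- elim: (thead v) y z => [|n IHn] y z /=; first exact: IHf.
  move=> [r rP gy] [r' r'P gz].
  by rewrite -(IHn _ _ rP r'P) in gz; exact: IHg gy gz.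
- move=> [fy miny] [fz minz]; case: (ltngtP y z) => // lt_yz.
  + by have [u fu] := minz _ lt_yz; have := IHf _ _ _ fy fu.
  + by have [u fu] := miny _ lt_yz; have := IHf _ _ _ fz fu.
Qed.

(* A single program must halt, with output 0 or 1, on the code of every
   admissible instance; nothing is required on other inputs. *)
Definition algorithmically_decidable (T : Type) (code : T -> nat)
    (admissible Q : T -> Prop) : Prop :=
  exists p : recfun 1, forall x : T, admissible x ->
    exists b : bool, rec_eval p [tuple code x] b /\ (b <-> Q x).

(* Finite sets of rational matrices of a common size, given by a list of their
   elements in any order and possibly with repetitions. *)
Definition instance : Type := {n : nat & seq 'M[rat]_n}.

Definition stochastic_instance (I : instance) : Prop :=
  forall A, A \in tagged I -> stochastic A.

Definition instance_set (R : realType) (I : instance) : set 'M[R]_(tag I) :=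
  [set map_mx ratr A | A in [set` tagged I]].

(* Finite lists are coded by the bijection [CodeSeq.code : seq nat -> nat],
   [code (a :: s) = 2 ^ a * (2 * code s + 1)], and a rational number by its
   sign, numerator and denominator in lowest terms. *)
Definition code_rat (q : rat) : nat :=
  CodeSeq.code [:: nat_of_bool (q < 0); `|numq q|%N; `|denq q|%N].

Definition code_mx (n : nat) (A : 'M[rat]_n) : nat :=
  CodeSeq.code
    [seq CodeSeq.code [seq code_rat (A i j) | j <- enum 'I_n] | i <- enum 'I_n].

Definition code_instance (I : instance) : nat :=
  CodeSeq.code [:: tag I; CodeSeq.code [seq code_mx A | A <- tagged I]].

(* Main.v *)
Require Import Defs.
From mathcomp Require Import all_boot all_order all_algebra.
From mathcomp Require Import all_classical all_reals all_analysis.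
From mathcomp Require Import zify lra ring.

(** Call a pair (S, T) of nonempty disjoint sets of coordinates separating, and
say that A leads from (S, T) to (S', T') when the rows of A indexed by S have
their support in S' and those indexed by T have their support in T'. After
[x' = A *m x], the coordinates of x' in S then depend only on those of x in S',
and likewise for T and T'. A trap is a nonempty collection of separating pairs
in which each pair leads to another one by some matrix of the given set. Traps
are finite objects, and the given set is a consensus set exactly when it admits
no trap.

If there is a trap, some cycle of separating pairs can be followed backwards
for ever; a trajectory that starts with the value 1 on the first set of the
initial pair and 0 on the second one keeps the values 1 and 0 on the two sets
of the current pair, so it does not approach consensus
([trap_not_consensus]). If there is no trap, take a product of as many factors
as there are pairs of sets. Were two of its rows to have disjoint supports, the
supports of these two rows in the partial products would give a long walk
through separating pairs; this walk repeats a pair, and the resulting cycle is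
a trap. So any two rows of such a product share a column with nonzero entries
([chain_scrambling]). Since there are finitely many matrices, these entries are
bounded below, so every such block of steps contracts the spread of the state
by a fixed factor ([spread_contract]), which forces convergence to a constant
vector ([consensus_of_no_trap]).

The existence of a trap is decided by exhaustive search. With sets coded by the
bits of natural numbers, it becomes a formula made of boolean connectives,
quantifiers bounded by computable functions, bit tests and accesses to the
coded input ([has_trap], [has_trapP]). Functions computed by total programs are
closed under all these constructions, so a program is obtained by following the
structure of the formula ([computable_has_trap]). *)

Set Implicit Arguments.
Unset Strict Implicit.
Unset Printing Implicit Defensive.
Import Order.TTheory GRing.Theory Num.Theory.
Import numFieldNormedType.Exports.

(** * Functions computed by total programs *)

(** The arguments are passed as an untyped environment, whose variables are read
with [head] and [behead]: a bound variable is pushed in front of the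
environment, and open terms need no arity bookkeeping. Only environments of
size [k] are constrained. *)
Definition computable (k : nat) (f : seq nat -> nat) : Prop :=
  exists p : recfun k, forall v : k.-tuple nat, rec_eval p v (f v).

Lemma computable_ext k f g : f =1 g -> computable k f -> computable k g.
Proof. by move=> fg [p pP]; exists p => v; rewrite -fg. Qed.

(** A variable beyond the arity reads the default value 0 of [head]. *)
Lemma computable_var k i : computable k (fun s => head 0 (iter i behead s)).
Proof.
have hE (s : seq nat) : head 0 (iter i behead s) = nth 0 s i.
  rewrite -nth0; elim: i s => [//|i IH] s.
  by rewrite iterSr IH nth_behead.
apply: (@computable_ext k (fun s => nth 0 s i)) => [s|]; first by rewrite hE.
have [lt_ik|le_ki] := ltnP i k.
  by exists (Rproj (Ordinal lt_ik)) => v /=; rewrite (tnth_nth 0).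
by exists (Rzero k) => v /=; rewrite nth_default ?size_tuple.
Qed.

(** Substitution: it is used to replace a compound argument by a variable, so that
the argument can occur below a recursion or a search without being moved to a
larger environment. *)
Lemma computable_let k b f :
  computable k b -> computable k.+1 f -> computable k (fun s => f (b s :: s)).
Proof.
move=> [pb bP] [pf fP].
exists (Rcomp pf (fun i => if unlift ord0 i is Some j then Rproj j else pb)).
move=> v /=; exists [tuple of b v :: v]; last exact: fP.
move=> i; case: unliftP => [j ->|->]; last exact: bP.
by rewrite tnthS.
Qed.

Lemma computable_rec k (b base : seq nat -> nat)
    (step : nat -> nat -> seq nat -> nat) :
  computable k b -> computable k base ->
  computable k.+2
    (fun t => step (head 0 t) (head 0 (behead t)) (behead (behead t))) ->
  computable k
    (fun s => nat_rect (fun=> nat) (base s) (fun i r => step i r s) (b s)).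
Proof.
move=> bP [p0 p0P] [p1 p1P].
suff: computable k.+1 (fun t => nat_rect (fun=> nat) (base (behead t))
    (fun i r => step i r (behead t)) (head 0 t)).
  by move/(computable_let bP).
exists (Rprec p0 p1) => v /=.
have -> : head 0 v = thead v by case/tupleP: v => x v; rewrite theadE.
elim: (thead v) => [|x IH] /=; first exact: p0P.
by eexists; [exact: IH | exact: p1P [tuple of x :: _ :: behead v]].
Qed.

Lemma computable0 k : computable k (fun=> 0).
Proof. by exists (Rzero k). Qed.

Lemma computable_succ k f : computable k f -> computable k (fun s => (f s).+1).
Proof.
move=> [p pP]; exists (Rcomp Rsucc (fun=> p)) => v.
by exists [tuple of nseq 1 (f v)] => [i|] /=; first by rewrite tnth_nseq.
Qed.

Lemma computable_iter k b base (step : nat -> seq nat -> nat) :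
  computable k b -> computable k base ->
  computable k.+2 (fun t => step (head 0 (behead t)) (behead (behead t))) ->
  computable k (fun s => iter (b s) (fun r => step r s) (base s)).
Proof.
move=> bP aP sP.
apply: computable_ext (computable_rec (step := fun _ => step) bP aP sP) => s.
by elim: (b s) => //= m ->.
Qed.

Lemma computable_pred k f : computable k f -> computable k (fun s => (f s).-1).
Proof.
move=> fP; apply: computable_ext
  (computable_rec (step := fun i _ _ => i) fP (computable0 k) (computable_var _ 0)).
by move=> s; case: (f s).
Qed.

Lemma computable_add k f g :
  computable k f -> computable k g -> computable k (fun s => f s + g s).
Proof.
move=> fP gP; apply: computable_ext (computable_iter (step := fun r _ => r.+1)
  fP gP (computable_succ (computable_var _ 1))).
by move=> s; rewrite iter_succn addnC.
Qed.

Lemma computable_sub k f g :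
  computable k f -> computable k g -> computable k (fun s => f s - g s).
Proof.
move=> fP gP; apply: computable_ext (computable_iter (step := fun r _ => r.-1)
  gP fP (computable_pred (computable_var _ 1))).
by move=> s; rewrite iter_predn.
Qed.

Lemma computable_neg k (P : pred (seq nat)) :
  computable k P -> computable k (fun s => ~~ P s).
Proof.
move=> PP; apply: computable_ext
  (computable_sub (computable_succ (computable0 k)) PP).
by move=> s; case: (P s).
Qed.

Lemma computable_and k (P Q : pred (seq nat)) :
  computable k P -> computable k Q -> computable k (fun s => P s && Q s).
Proof.
move=> PP QP; apply: computable_ext (computable_pred (computable_add PP QP)).
by move=> s; case: (P s); case: (Q s).
Qed.

Lemma computable_imp k (P Q : pred (seq nat)) :
  computable k P -> computable k Q -> computable k (fun s => P s ==> Q s).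
Proof.
move=> PP QP; apply: computable_ext
  (computable_neg (computable_and PP (computable_neg QP))).
by move=> s; case: (P s); case: (Q s).
Qed.

Lemma computable_neq0 k f : computable k f -> computable k (fun s => f s != 0).
Proof.
move=> fP; apply: computable_ext
  (computable_sub fP (computable_pred fP)).
by move=> s; case: (f s) => // m; rewrite /= subSn ?subnn.
Qed.

(** The searched value is specified rather than computed, so that [f] can be given
by any convenient mathematical expression; the two conditions make the search
terminate at [f s]. *)
Lemma computable_mu k (P : nat -> pred (seq nat)) f :
  computable k.+1 (fun t => P (head 0 t) (behead t)) ->
  (forall s, P (f s) s) -> (forall s y, y < f s -> ~~ P y s) ->
  computable k f.
Proof.
move=> /computable_neg[p pP] fP minf; exists (Rmu p) => v /=; split.
  by have := pP [tuple of f v :: v]; rewrite /= fP.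
move=> z /minf/negbTE nPz; exists 0.
by have := pP [tuple of z :: v]; rewrite /= nPz.
Qed.

Lemma computable_odd k f : computable k f -> computable k (fun s => odd (f s)).
Proof.
move=> fP; apply: computable_ext (computable_iter (step := fun r _ => 1 - r)
  fP (computable0 k)
  (computable_sub (computable_succ (computable0 _)) (computable_var _ 1))).
by move=> s; elim: (f s) => //= m ->; case: (odd m).
Qed.

(** The recursion rests on [m.+1./2 = m - m./2]. *)
Lemma computable_half k f : computable k f -> computable k (fun s => (f s)./2).
Proof.
move=> fP; apply: computable_ext (computable_rec (step := fun i r _ => i - r)
  fP (computable0 k)
  (computable_sub (computable_var _ 0) (computable_var _ 1))).
by move=> s; elim: (f s) => //= m ->; rewrite uphalf_half; lia.
Qed.

Lemma computable_exp2 k f : computable k f -> computable k (fun s => 2 ^ f s).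
Proof.
move=> fP; apply: computable_ext (computable_iter (step := fun r _ => r + r)
  fP (computable_succ (computable0 k))
  (computable_add (computable_var _ 1) (computable_var _ 1))).
by move=> s; elim: (f s) => //= m ->; rewrite addnn -mul2n -expnS.
Qed.

(** Weakening at the second position: in the recursion that evaluates a bounded
quantifier, the environment holds the accumulator between the counter and the
outer variables, and the quantified predicate must not see it. *)
Lemma computable_skip k f :
  computable k.+1 f ->
  computable k.+2 (fun t => f (head 0 t :: behead (behead t))).
Proof.
move=> [p pP]; exists (Rcomp p (fun i => Rproj (lift (lift ord0 ord0) i))) => v.
exists [tuple of head 0 v :: behead (behead v)] => /= [i|]; last exact: pP.
rewrite !(tnth_nth 0) /= /bump.
by case: i => [[|i] /= _]; rewrite ?nth0 // !nth_behead.
Qed.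

Lemma computable_all k b (P : nat -> pred (seq nat)) :
  computable k b -> computable k.+1 (fun t => P (head 0 t) (behead t)) ->
  computable k (fun s => all (fun i => P i s) (iota 0 (b s))).
Proof.
move=> bP PP; apply: computable_ext (computable_rec
  (step := fun i r s => (r != 0) && P i s) bP (computable_succ (computable0 k))
  (computable_and (computable_neq0 (computable_var _ 1)) (computable_skip PP))).
move=> s; elim: (b s) => // m IH.
have -> : iota 0 m.+1 = rcons (iota 0 m) m by rewrite -addn1 iotaD cats1.
by rewrite all_rcons /= IH andbC; case: (all _ _).
Qed.

Lemma computable_has k b (P : nat -> pred (seq nat)) :
  computable k b -> computable k.+1 (fun t => P (head 0 t) (behead t)) ->
  computable k (fun s => has (fun i => P i s) (iota 0 (b s))).
Proof.
move=> bP PP.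
apply: computable_ext (computable_neg (computable_all bP (computable_neg PP))).
by move=> s; congr nat_of_bool; rewrite -[RHS]negbK -all_predC.
Qed.

Definition bit (w i : nat) : bool := odd (iter i half w).

Lemma computable_bit k f g :
  computable k f -> computable k g -> computable k (fun s => bit (f s) (g s)).
Proof.
move=> fP gP; apply: computable_odd.
exact: computable_iter gP fP (computable_half (computable_var _ 1)).
Qed.

Lemma iter_half_exp2 d y m : iter y half (2 ^ (y + d) * m) = 2 ^ d * m.
Proof.
elim: y => // y IH; rewrite iterSr addSn expnS -mulnA mul2n doubleK.
exact: IH.
Qed.

(** The head of a coded list is the position of the lowest bit of the code. *)
Lemma bit_code a s y : y <= a -> bit (CodeSeq.code (a :: s)) y = (y == a).
Proof.
move=> ya; rewrite /bit /= -(subnKC ya) iter_half_exp2 oddM /= odd_double andbT.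
by rewrite oddX; case: ltngtP ya => //; lia.
Qed.

Lemma computable_head_decode k f :
  computable k f -> computable k (fun s => head 0 (CodeSeq.decode (f s))).
Proof.
move=> fP; apply: (computable_let (f := fun t => head 0 (CodeSeq.decode (head 0 t))) fP).
apply: (computable_mu (P := fun y s => (head 0 s != 0) ==> bit (head 0 s) y)).
- apply: computable_imp; first exact: computable_neq0 (computable_var _ 1).
  exact: computable_bit (computable_var _ 1) (computable_var _ 0).
- move=> s; rewrite -[head 0 s]CodeSeq.decodeK.
  move: (CodeSeq.decode (head 0 s)) => {s}.
  by case=> [|a s] //; rewrite CodeSeq.codeK bit_code // eqxx implybT.
- move=> s y /=; rewrite -[head 0 s]CodeSeq.decodeK.
  move: (CodeSeq.decode (head 0 s)) => {s}.
  case=> [|a s]; rewrite CodeSeq.codeK //= => lt_ya.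
  rewrite negb_imply -/(CodeSeq.code (a :: s)) bit_code ?(ltnW lt_ya) //.
  by rewrite (ltn_eqF lt_ya) andbT muln_eq0 expn_eq0.
Qed.

(** In [2 ^ a * (2 * c + 1)], halving [a] times exposes the odd factor, and once
more leaves [c]. *)
Lemma computable_behead_decode k f :
  computable k f ->
  computable k (fun s => CodeSeq.code (behead (CodeSeq.decode (f s)))).
Proof.
move=> fP; apply: (@computable_ext k
  (fun s => iter (head 0 (CodeSeq.decode (f s))).+1 half (f s))).
  move=> s; rewrite -[f s]CodeSeq.decodeK CodeSeq.codeK.
  case: (CodeSeq.decode _) => [|a l] //.
  by rewrite /= -{2}(addn0 a) iter_half_exp2 mul1n /= uphalf_double.
apply: computable_iter => //.
  exact: computable_succ (computable_head_decode _).
exact: computable_half (computable_var _ 1).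
Qed.

Lemma computable_drop_decode k f g :
  computable k f -> computable k g ->
  computable k (fun s => CodeSeq.code (drop (g s) (CodeSeq.decode (f s)))).
Proof.
move=> fP gP; apply: computable_ext (computable_iter
  (step := fun r _ => CodeSeq.code (behead (CodeSeq.decode r))) gP fP
  (computable_behead_decode (computable_var _ 1))).
move=> s; elim: (g s) => [|m IH] /=; first by rewrite drop0 CodeSeq.decodeK.
by rewrite IH CodeSeq.codeK -drop1 drop_drop add1n.
Qed.

Lemma computable_nth_decode k f g :
  computable k f -> computable k g ->
  computable k (fun s => nth 0 (CodeSeq.decode (f s)) (g s)).
Proof.
move=> fP gP; apply: computable_ext
  (computable_head_decode (computable_drop_decode fP gP)).
by move=> s; rewrite CodeSeq.codeK -nth0 nth_drop addn0.
Qed.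

(** Dropping too many elements of a list leaves the empty one, the only list with
code 0. *)
Lemma computable_lt_size_decode k f g :
  computable k f -> computable k g ->
  computable k (fun s => f s < size (CodeSeq.decode (g s))).
Proof.
move=> fP gP; apply: computable_ext
  (computable_neq0 (computable_drop_decode gP fP)).
move=> s; rewrite ltnNge; case: leqP => [/drop_oversize -> //|lt_s].
by rewrite (drop_nth 0 lt_s) /= muln_eq0 expn_eq0.
Qed.

(** It turns a search for a position in a coded list into a search bounded by the
code itself. *)
Lemma size_code s : size s <= CodeSeq.code s.
Proof.
elim: s => //= a s IH; apply: (@leq_trans (1 * (CodeSeq.code s).*2.+1)); first lia.
by rewrite leq_mul2r expn_gt0.
Qed.

(** * Traps *)

Local Open Scope classical_set_scope.
Local Open Scope ring_scope.

Definition separating (n : nat) (p : {set 'I_n} * {set 'I_n}) : bool :=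
  [&& p.1 != finset.set0, p.2 != finset.set0 & [disjoint p.1 & p.2]].

(** An inclusion of supports is required, not an equality: the sets of a trap may
then be chosen freely, and checking a given trap needs no computation of
images. *)
Definition supported (K : numDomainType) (n : nat) (A : 'M[K]_n)
    (S T : {set 'I_n}) : bool :=
  [forall i in S, forall j, (A i j != 0) ==> (j \in T)].

Definition trap (K : numDomainType) (n : nat) (Ps : set 'M[K]_n)
    (W : {set {set 'I_n} * {set 'I_n}}) : Prop :=
  W != finset.set0 /\ forall p, p \in W -> separating p /\
    exists A q, [/\ Ps A, q \in W, supported A p.1 q.1 & supported A p.2 q.2].

Lemma supportedP (K : numDomainType) (n : nat) (A : 'M[K]_n)
    (S T : {set 'I_n}) :
  reflect (forall i j, i \in S -> A i j != 0 -> j \in T) (supported A S T).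
Proof.
apply: (iffP forall_inP) => [h i j iS Aij|h i iS].
  by have /forallP/(_ j)/implyP := h i iS; apply.
by apply/forallP => j; apply/implyP; exact: h.
Qed.

(** The forward orbit of [x] ends in a cycle, along which [f] can be inverted for
ever. *)
Lemma backward_orbit (T : finType) (f : T -> T) (W : {set T}) (x : T) :
  x \in W -> (forall y, y \in W -> f y \in W) ->
  exists y : nat -> T, (forall t, y t \in W) /\ (forall t, f (y t.+1) = y t).
Proof.
move=> xW fW.
have iterW m : iter m f x \in W by elim: m => //= m; exact: fW.
have /trajectP[a lt_a eq_a] := looping_order f x.
set b := fingraph.order f x in lt_a eq_a.
(* The orbit has period [b - a] from rank [a] on, so that [b - a - 1] further
   steps undo one step. *)
have per k : iter (k + b) f x = iter (k + a) f x by rewrite !iterD eq_a.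
exists (fun t => iter (a + (b - a).-1 * t) f x); split=> // t.
rewrite -iterS -[X in _ = X]/(iter _ f x).
have -> : (a + (b - a).-1 * t.+1).+1 = (((b - a).-1 * t) + b)%N by nia.
by rewrite per addnC.
Qed.

Lemma stochastic_mul_const (R : numDomainType) n (A : 'M[R]_n) (x : 'cV[R]_n)
    (c : R) (i : 'I_n) :
  stochastic A -> (forall j, A i j != 0 -> x j 0 = c) -> (A *m x) i 0 = c.
Proof.
move=> [_ sumA] xc; rewrite mxE -[RHS]mul1r -(sumA i) mulr_suml.
apply: eq_bigr => j _; have [->|Aij] := eqVneq (A i j) 0; first by rewrite !mul0r.
by rewrite xc.
Qed.

(** Matrices act on column vectors, so a step of the trajectory reads the pair to
which the current matrix leads and writes the pair from which it leads there:
time runs against the arrows of the trap, whence the backward orbit. *)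
Lemma trap_not_consensus (R : realType) (n : nat) (Ps : set 'M[R]_n) W :
  (forall A, Ps A -> stochastic A) -> trap Ps W -> ~ consensus_set Ps.
Proof.
move=> stPs [W0 trapW] cons.
have /choice[g gP] (p : {set 'I_n} * {set 'I_n}) :
    exists Aq : 'M[R]_n * ({set 'I_n} * {set 'I_n}), p \in W ->
    [/\ Ps Aq.1, Aq.2 \in W, supported Aq.1 p.1 Aq.2.1 & supported Aq.1 p.2 Aq.2.2].
  have [/trapW[_ [A [q h]]]|_] := boolP (p \in W); first by exists (A, q).
  by exists (0, p).
have /finset.set0Pn[p0 p0W] := W0.
have gW p : p \in W -> (g p).2 \in W by case/gP.
have [y [yW yE]] := backward_orbit p0W gW.
pose x0 : 'cV[R]_n := \col_i (i \in (y 0%N).1)%:R.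
pose P t := (g (y t)).1.
have PsP t : Ps (P t) by have [] := gP _ (yW t).
have inv t : (forall i, i \in (y t).1 -> trajectory P x0 t i 0 = 1) /\
             (forall i, i \in (y t).2 -> trajectory P x0 t i 0 = 0).
  elim: t => [|t [IH1 IH2]] /=.
    split=> i iy; rewrite mxE; first by rewrite iy.
    have [/and3P[_ _ dis] _] := trapW _ (yW 0%N).
    by have := disjointFl dis iy => ->.
  have [_ _ /supportedP s1 /supportedP s2] := gP _ (yW t.+1).
  rewrite yE in s1 s2.
  split=> i iy; apply: stochastic_mul_const (stPs _ (PsP _)) _ => j Pij.
    by apply: IH1; exact: s1 Pij.
  by apply: IH2; exact: s2 Pij.
have [alpha cvgx] := cons P x0 (fun t _ => PsP t).
have /cvg_ballP/(_ (1/2)) := cvgx.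
have half0 : 0 < 1/2 :> R by lra.
move=> /(_ half0) [N _ /(_ N (leqnn N))] /= near.
have [/and3P[/finset.set0Pn[i iy] /finset.set0Pn[j jy] _] _] := trapW _ (yW N).
case: near => _ near; have := near i 0; have := near j 0.
rewrite /ball /= !mxE ((inv N).1 i) // ((inv N).2 j) //.
by rewrite !ltr_norml; lra.
Qed.

(** * Products of stochastic matrices *)

Lemma stochastic1 (K : numDomainType) n : stochastic (1%:M : 'M[K]_n).
Proof.
split=> [i j|i]; first by rewrite mxE ler0n.
rewrite (bigD1 i) //= mxE eqxx big1 ?addr0 // => j ji.
by rewrite mxE eq_sym (negbTE ji).
Qed.

Lemma stochastic_mul (K : numDomainType) n (A B : 'M[K]_n) :
  stochastic A -> stochastic B -> stochastic (A *m B).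
Proof.
move=> [A0 A1] [B0 B1]; split=> [i j|i].
  by rewrite mxE sumr_ge0 // => k _; rewrite mulr_ge0.
under eq_bigr do rewrite mxE.
rewrite exchange_big /= -(A1 i); apply: eq_bigr => k _.
by rewrite -mulr_sumr B1 mulr1.
Qed.

Lemma stochastic_row_neq0 (K : numDomainType) n (A : 'M[K]_n) i :
  stochastic A -> exists j, A i j != 0.
Proof.
move=> [_ A1]; apply/existsP; apply/contraT => /existsPn A0.
have := A1 i; rewrite big1 => [/esym/eqP|j _]; first by rewrite oner_eq0.
by apply/eqP; have := A0 j; rewrite negbK.
Qed.

Lemma ge0_mul_entry_ge (K : numDomainType) n (A B : 'M[K]_n) i j k :
  (forall i j, 0 <= A i j) -> (forall i j, 0 <= B i j) ->
  A i j * B j k <= (A *m B) i k.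
Proof.
move=> A0 B0; rewrite mxE (bigD1 j) //= lerDl sumr_ge0 // => l _.
by rewrite mulr_ge0.
Qed.

Lemma mul_entry_neq0 (K : numDomainType) n (A B : 'M[K]_n) i j k :
  stochastic A -> stochastic B ->
  A i j != 0 -> B j k != 0 -> (A *m B) i k != 0.
Proof.
move=> [A0 _] [B0 _] Aij Bjk; rewrite gt_eqF //.
apply: lt_le_trans (ge0_mul_entry_ge i j k A0 B0).
by rewrite mulr_gt0 // lt0r ?Aij ?Bjk ?A0 ?B0.
Qed.

(** Factors are appended on the right: the supports of the rows of the successive
products then evolve by the supports of the rows of one factor at a time. *)
Fixpoint chain (K : pzRingType) (n : nat) (M : nat -> 'M[K]_n) (k : nat) : 'M[K]_n :=
  if k is l.+1 then chain M l *m M l else 1%:M.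

Lemma stochastic_chain (K : numDomainType) n (M : nat -> 'M[K]_n) k :
  (forall l, stochastic (M l)) -> stochastic (chain M k).
Proof.
move=> stM; elim: k => [|k IH] /=; first exact: stochastic1.
exact: stochastic_mul.
Qed.

Lemma chain_entry_ge (K : numDomainType) n (M : nat -> 'M[K]_n) (e : K) k :
  0 < e -> (forall l, stochastic (M l)) ->
  (forall l i j, M l i j != 0 -> e <= M l i j) ->
  forall i j, chain M k i j != 0 -> e ^+ k <= chain M k i j.
Proof.
move=> e0 stM eM; elim: k => [|k IH] i j /=.
  by rewrite expr0 mxE; case: (i == j); rewrite ?lexx // eqxx.
have [C0 _] := stochastic_chain k stM; have [M0 _] := stM k.
move=> nz; have [l /andP[Cl Ml]] :
    exists l, (chain M k i l != 0) && (M k l j != 0).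
  apply/existsP; apply: contraNT nz => /existsPn h; rewrite mxE.
  rewrite big1 // => l _; apply/eqP; have := h l.
  by rewrite negb_and !negbK mulf_eq0.
apply: le_trans (ge0_mul_entry_ge i l j C0 M0).
by rewrite exprSr ler_pM ?exprn_ge0 ?(ltW e0) ?IH ?eM.
Qed.

Definition row_support (K : nmodType) (n : nat) (A : 'M[K]_n) (i : 'I_n) : {set 'I_n} :=
  [set j | A i j != 0]%SET.

Lemma pigeonhole_nat (T : finType) (u : nat -> T) :
  exists a b, [/\ (a < b)%N, (b <= #|T|)%N & u a = u b].
Proof.
have /injectivePn[x [y xy uxy]] : ~~ injectiveb (fun i : 'I_(#|T|.+1) => u i).
  by apply/injectiveP => /leq_card; rewrite card_ord ltnn.
have := ltn_ord x; have := ltn_ord y; rewrite !ltnS => yT xT.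
case: (ltngtP x y) => [lt|lt|/val_inj eq].
- by exists x, y.
- by exists y, x.
- by rewrite eq eqxx in xy.
Qed.

(** The supports of the rows [i1] and [i2] of the partial products form separating
pairs as long as they are disjoint, and once they meet they meet for ever. If
they were still disjoint after as many factors as there are pairs, a pair would
be repeated and the pairs between its two occurrences would form a trap. *)
Lemma chain_scrambling (K : numDomainType) n (Ps : set 'M[K]_n) (M : nat -> 'M[K]_n) :
  (forall A, Ps A -> stochastic A) -> (forall W, ~ trap Ps W) ->
  (forall k, Ps (M k)) -> forall i1 i2, exists j,
  let C := chain M #|{: {set 'I_n} * {set 'I_n}}| in C i1 j != 0 /\ C i2 j != 0.
Proof.
set N := #|_| => stPs notrap PsM i1 i2; apply: contrapT => nocommon.
have stM k := stPs _ (PsM k); have stC k := stochastic_chain k stM.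
pose u k := (row_support (chain M k) i1, row_support (chain M k) i2).
have [a [b [ab bN uab]]] := pigeonhole_nat u.
have supp i k : supported (M k) (row_support (chain M k) i) (row_support (chain M k.+1) i).
  apply/supportedP => j l; rewrite !inE => Cij Mjl; exact: mul_entry_neq0 Mjl.
have later k d j : chain M k i1 j != 0 -> chain M k i2 j != 0 ->
    exists l, chain M (k + d) i1 l != 0 /\ chain M (k + d) i2 l != 0.
  move=> C1 C2; elim: d => [|d [l [l1 l2]]]; first by exists j; rewrite addn0.
  have [m Mlm] := stochastic_row_neq0 l (stM (k + d)%N).
  by exists m; rewrite addnS; split; exact: mul_entry_neq0 Mlm.
have sep k : (k <= N)%N -> separating (u k).
  move=> kN; apply/and3P; split.
  - by have [j Cj] := stochastic_row_neq0 i1 (stC k); apply/finset.set0Pn; exists j; rewrite inE.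
  - by have [j Cj] := stochastic_row_neq0 i2 (stC k); apply/finset.set0Pn; exists j; rewrite inE.
  - apply/pred0P => j /=; apply/negP => /andP[]; rewrite !inE => C1 C2.
    by have := later k (N - k)%N j C1 C2; rewrite subnKC.
apply: (notrap [set u k | k : 'I_b & (a <= k)%N]%SET); split.
  by apply/finset.set0Pn; exists (u a); apply/imsetP; exists (Ordinal ab); rewrite ?inE /=.
move=> p /imsetP[k]; rewrite inE => ak ->; split.
  by apply: sep; apply: leq_trans bN; exact: ltnW.
exists (M k), (u k.+1); split; [exact: PsM| |exact: supp|exact: supp].
have [lt_kb|] := ltnP k.+1 b.
  by apply/imsetP; exists (Ordinal lt_kb); rewrite ?inE //= leqW.
move=> le_bk; have -> : k.+1 = b by have := ltn_ord k; lia.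
by rewrite -uab; apply/imsetP; exists (Ordinal ab); rewrite ?inE /=.
Qed.

(** * Contraction and convergence *)

Definition spread_le (R : numDomainType) (n : nat) (x : 'cV[R]_n) (r : R) : Prop :=
  forall j k, x j 0 - x k 0 <= r.

(** The two rows are probability distributions with a mass [d] in common at some
column [l]. Removing it leaves two distributions of total mass [1 - d], whose
averages of [x], normalized, differ by at most [r]. *)
Lemma spread_contract (R : realFieldType) n (A : 'M[R]_n) (x : 'cV[R]_n) (d r : R) :
  stochastic A -> d < 1 ->
  (forall i1 i2, exists j, d <= A i1 j /\ d <= A i2 j) ->
  0 <= d -> spread_le x r -> spread_le (A *m x) ((1 - d) * r).
Proof.
move=> [A0 A1] d1 scr d0 xr i1 i2; have [l [l1 l2]] := scr i1 i2.
pose p i j := A i j - d * (j == l)%:R.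
have sum_p i : \sum_j p i j = 1 - d.
  rewrite sumrB A1 -mulr_sumr (bigD1 l) //= eqxx big1 ?addr0 ?mulr1 //.
  by move=> j /negbTE ->.
have p_ge0 i j : d <= A i l -> 0 <= p i j.
  rewrite /p; have [->|_] := eqVneq j l; first by rewrite mulr1 subr_ge0.
  by rewrite mulr0 subr0.
have mulE i : (A *m x) i 0 = \sum_j p i j * x j 0 + d * x l 0.
  rewrite mxE -[d * x l 0]addr0.
  transitivity (\sum_j (p i j * x j 0 + d * (j == l)%:R * x j 0)).
    by apply: eq_bigr => j _; rewrite /p; ring.
  rewrite big_split /=; congr (_ + _); rewrite (bigD1 l) //= eqxx mulr1.
  by rewrite big1 // => j /negbTE ->; rewrite mulr0 mul0r.
(* Multiplying by [1 - d] turns the difference of the two averages into a double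
   sum of differences of coordinates, weighted by the products of masses. *)
have m0 : 0 < 1 - d by rewrite subr_gt0.
rewrite !mulE -(ler_pM2l m0) opprD addrACA subrr addr0.
have -> : (1 - d) * (\sum_j p i1 j * x j 0 - \sum_k p i2 k * x k 0) =
    \sum_j \sum_k p i1 j * p i2 k * (x j 0 - x k 0).
  transitivity (\sum_j (p i1 j * x j 0 * (1 - d) - p i1 j * \sum_k p i2 k * x k 0)).
    rewrite sumrB -!mulr_suml sum_p; ring.
  apply: eq_bigr => j _; rewrite -{1}(sum_p i2) !mulr_sumr -sumrB.
  by apply: eq_bigr => k _; ring.
apply: (@le_trans _ _ (\sum_j \sum_k p i1 j * p i2 k * r)).
  apply: ler_sum => j _; apply: ler_sum => k _.
  by rewrite ler_wpM2l ?mulr_ge0 ?p_ge0.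
under eq_bigr => j _ do rewrite -mulr_suml -mulr_sumr sum_p.
by rewrite -!mulr_suml sum_p mulrA.
Qed.

Lemma stochastic_mul_within (R : numDomainType) n (A : 'M[R]_n) (x : 'cV[R]_n)
    (lo hi : R) :
  stochastic A -> (forall j, lo <= x j 0 <= hi) ->
  forall i, lo <= (A *m x) i 0 <= hi.
Proof.
move=> [A0 A1] xb i; rewrite mxE -[lo]mul1r -[hi]mul1r -(A1 i) !mulr_suml.
by apply/andP; split; apply: ler_sum => j _; rewrite ler_wpM2l //; case/andP: (xb j).
Qed.

(** The intervals containing all the coordinates at some time contain them for ever
after, so any two of them meet; the limit is the supremum of their left ends. *)
Lemma consensus_of_spread (R : realType) n (P : nat -> 'M[R]_n) (x0 : 'cV[R]_n) :
  (forall t, (0 < t)%N -> stochastic (P t)) ->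
  (forall e, 0 < e -> exists t, spread_le (trajectory P x0 t) e) ->
  exists alpha, trajectory P x0 t @[t --> \oo] --> (const_mx alpha : 'cV[R]_n).
Proof.
case: n P x0 => [|n] P x0 stP sp.
  exists 0; rewrite (_ : trajectory P x0 = fun=> const_mx 0); first exact: cvg_cst.
  by apply/funext => t; apply/matrixP => -[].
set x := trajectory P x0.
have within t s lo hi : (forall i, lo <= x t i 0 <= hi) ->
    forall i, lo <= x (t + s)%N i 0 <= hi.
  move=> xt; elim: s => [|s IH]; first by rewrite addn0.
  by rewrite addnS; exact: stochastic_mul_within (stP _ _) IH.
pose E : set R := [set c | exists t hi, forall i, c <= x t i 0 <= hi].
have Ele t lo hi c : (forall i, lo <= x t i 0 <= hi) -> E c -> c <= hi.
  move=> xt [s [hi' xs]].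
  have /(_ ord0)/andP[_ le1] := within _ s _ _ xt.
  have /(_ ord0)/andP[le2 _] := within _ t _ _ xs.
  by rewrite addnC in le2; exact: le_trans le1.
have alphaP t lo hi : (forall i, lo <= x t i 0 <= hi) -> lo <= sup E <= hi.
  move=> xt; have Elo : E lo by exists t, hi.
  apply/andP; split; last by apply: ge_sup; [exists lo | move=> c; exact: Ele xt].
  by apply: ub_le_sup => //; exists hi => c; exact: Ele xt.
exists (sup E); apply/cvg_ballP => e e0.
have [t spt] := sp (e / 4) ltac:(lra).
pose m := x t ord0 0.
have xt i : m - e / 4 <= x t i 0 <= m + e / 4.
  have := spt i ord0; have := spt ord0 i; rewrite -/x -/m; lra.
exists t => // s /= ts; split=> // i j; rewrite (ord1 j) mxE.
have := within _ (s - t)%N _ _ xt i; rewrite subnKC // => xs.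
have := alphaP _ _ _ xt; rewrite /ball /= ltr_norml; move: xs.
by rewrite -/x; lra.
Qed.

(** The indices are written as successors so that all the factors of the chain,
including those beyond its length, are matrices used by the trajectory. *)
Lemma trajectory_chain (R : pzRingType) n (P : nat -> 'M[R]_n) (x0 : 'cV[R]_n) t k m :
  (m <= k)%N ->
  trajectory P x0 (t + k) =
  chain (fun l => P (t + k - l.+1).+1) m *m trajectory P x0 (t + k - m).
Proof.
elim: m => [|m IH] mk /=; first by rewrite mul1mx subn0.
rewrite IH ?(ltnW mk) // -mulmxA; congr (_ *m _).
by have -> : (t + k - m = (t + k - m.+1).+1)%N by lia.
Qed.

(** Finiteness of the set enters only through the uniform lower bound [e] on the
nonzero entries. *)
Lemma consensus_of_no_trap (R : realType) (n : nat) (Ps : set 'M[R]_n) (e : R) :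
  (forall A, Ps A -> stochastic A) -> 0 < e ->
  (forall A i j, Ps A -> A i j != 0 -> e <= A i j) ->
  (forall W, ~ trap Ps W) -> consensus_set Ps.
Proof.
move=> stPs e0 ePs notrap P x0 PsP.
pose K := #|{: {set 'I_n} * {set 'I_n}}|.
(* The bound [1/2] keeps [1 - d] positive. *)
pose d := Num.min (e ^+ K) (1/2).
have d0 : 0 < d by rewrite lt_min exprn_gt0 //=; lra.
have d1 : d < 1 by rewrite gt_min; apply/orP; right; lra.
have contract t r : spread_le (trajectory P x0 t) r ->
    spread_le (trajectory P x0 (t + K)) ((1 - d) * r).
  rewrite (trajectory_chain _ _ _ (leqnn K)) addnK.
  set M := fun l => _; have PsM l : Ps (M l) by exact: PsP.
  have stM l := stPs _ (PsM l).
  apply: spread_contract (ltW d0); [exact: stochastic_chain | exact: d1 |].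
  move=> i1 i2; have [j /= [C1 C2]] := chain_scrambling stPs notrap PsM i1 i2.
  exists j; split; rewrite ge_min; apply/orP; left;
    by apply: chain_entry_ge => // l i k; exact: ePs.
have [r0 spr0] : exists r0, spread_le x0 r0.
  exists (\sum_j `|x0 j 0| *+ 2) => j k.
  rewrite sumrMnl mulr2n; apply: le_trans (ler_norm _) _.
  apply: le_trans (ler_normB _ _) _.
  by apply: lerD; [rewrite (bigD1 j) | rewrite (bigD1 k)] => //=;
     rewrite lerDl sumr_ge0.
have spread_pow m : spread_le (trajectory P x0 (m * K)) ((1 - d) ^+ m * r0).
  elim: m => [|m IH]; first by rewrite mul0n expr0 mul1r.
  by rewrite mulSn addnC exprS -mulrA; exact: contract.
apply: consensus_of_spread => [t /PsP/stPs //|eta eta0].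
have abs1 : `|1 - d| < 1 by rewrite ltr_norml; lra.
have := cvg_geometric r0 abs1 => /cvgrPdist_lt /(_ _ eta0)[m _ /(_ m (leqnn m))].
rewrite /= /geometric /= sub0r normrN mulrC => small.
exists (m * K)%N => j k; apply: le_trans (spread_pow m j k) _.
exact: le_trans (ler_norm _) (ltW small).
Qed.

(** * The search for a trap as an arithmetical formula *)

Local Open Scope nat_scope.

(** [M] codes a matrix; position 1 in the code of a rational number is the absolute
value of its numerator. *)
Definition entry_nonzero (M i j : nat) : bool :=
  nth 0 (CodeSeq.decode
    (nth 0 (CodeSeq.decode (nth 0 (CodeSeq.decode M) i)) j)) 1 != 0.

(** A pair of subsets of ['I_n] is coded by the [2 * n] low bits of a number [u],
those of index at least [n] giving the second set. *)
Definition mask_separating (n u : nat) : bool :=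
  has (fun i => bit u i) (iota 0 n) && has (fun i => bit u (n + i)) (iota 0 n) &&
  all (fun i => bit u i ==> ~~ bit u (n + i)) (iota 0 n).

Definition mask_supported (n M u v : nat) : bool :=
  all (fun i => all (fun j => entry_nonzero M i j ==>
    (bit u i ==> bit v j) && (bit u (n + i) ==> bit v (n + j)))
  (iota 0 n)) (iota 0 n).

(** [L] codes a list of matrices and the bits of [w] select codes of pairs. The
bound [L] on positions in the list is crude but directly available. *)
Definition mask_escapes (n L w u : nat) : bool :=
  has (fun v => bit w v && has (fun m => (m < size (CodeSeq.decode L)) &&
    mask_supported n (nth 0 (CodeSeq.decode L) m) u v) (iota 0 L))
  (iota 0 (2 ^ (n + n))).

Definition trap_mask (n L w : nat) : bool :=
  has (fun u => bit w u) (iota 0 (2 ^ (n + n))) &&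
  all (fun u => bit w u ==> mask_separating n u && mask_escapes n L w u)
      (iota 0 (2 ^ (n + n))).

Definition has_trap (n L : nat) : bool :=
  has (fun w => trap_mask n L w) (iota 0 (2 ^ (2 ^ (n + n)))).

(** It selects the closure lemma from the head symbol of the body, down to the
variables. *)
Ltac computability :=
  lazymatch goal with
  | |- computable _ (fun _ => nat_of_bool (all _ _)) => apply: computable_all
  | |- computable _ (fun _ => nat_of_bool (has _ _)) => apply: computable_has
  | |- computable _ (fun _ => nat_of_bool (_ && _)) => apply: computable_and
  | |- computable _ (fun _ => nat_of_bool (_ ==> _)) => apply: computable_imp
  | |- computable _ (fun _ => nat_of_bool (~~ (_ == _))) => apply: computable_neq0
  | |- computable _ (fun _ => nat_of_bool (~~ _)) => apply: computable_neg
  | |- computable _ (fun _ => nat_of_bool (bit _ _)) => apply: computable_bit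
  | |- computable _ (fun _ => nat_of_bool (_ < _)) =>
      apply: computable_lt_size_decode
  | |- computable _ (fun _ => nth 0 _ _) => apply: computable_nth_decode
  | |- computable _ (fun _ => 2 ^ _) => apply: computable_exp2
  | |- computable _ (fun _ => _ + _) => apply: computable_add
  | |- computable _ (fun _ => 0) => exact: computable0
  | |- computable _ (fun _ => _.+1) => apply: computable_succ
  | |- computable _ _ =>
      first [ exact: (computable_var _ 0) | exact: (computable_var _ 1)
            | exact: (computable_var _ 2) | exact: (computable_var _ 3)
            | exact: (computable_var _ 4) | exact: (computable_var _ 5)
            | exact: (computable_var _ 6) | exact: (computable_var _ 7)]
  end.

Lemma computable_has_trap :
  computable 1 (fun s => has_trap (nth 0 (CodeSeq.decode (head 0 s)) 0)
                                  (nth 0 (CodeSeq.decode (head 0 s)) 1)).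
Proof.
rewrite /has_trap /trap_mask /mask_escapes /mask_supported /mask_separating.
rewrite /entry_nonzero.
by repeat computability.
Qed.

(** * Correctness of the formula *)

Lemma has_iotaP (n : nat) (P : pred nat) :
  reflect (exists2 i, i < n & P i) (has P (iota 0 n)).
Proof.
by apply: (iffP hasP) => -[i]; rewrite ?mem_iota => ? ?; exists i; rewrite ?mem_iota.
Qed.

Lemma all_iotaP (n : nat) (P : pred nat) :
  reflect (forall i, i < n -> P i) (all P (iota 0 n)).
Proof.
apply: (iffP allP) => h i; first by move=> ?; apply: h; rewrite mem_iota.
by rewrite mem_iota; exact: h.
Qed.

Lemma mask_exists (N : nat) (P : pred nat) :
  exists2 w, w < 2 ^ N & forall k, k < N -> bit w k = P k.
Proof.
elim: N P => [|N IH] P; first by exists 0.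
have [w w_lt wP] := IH (fun k => P k.+1).
exists (P 0 + w.*2); first by rewrite expnS; case: (P 0); lia.
case=> [|k] kN; first by rewrite /bit /= oddD odd_double addbF oddb.
by rewrite /bit iterSr half_bit_double; exact: wP.
Qed.

Definition mask_pair (n u : nat) : {set 'I_n} * {set 'I_n} :=
  ([set i : 'I_n | bit u i], [set i : 'I_n | bit u (n + i)])%SET.

Lemma mask_pair_surj n (p : {set 'I_n} * {set 'I_n}) :
  exists2 u, u < 2 ^ (n + n) & mask_pair n u = p.
Proof.
have [u u_lt uP] := mask_exists (n + n) (fun k =>
  if k < n then [exists i in p.1, val i == k] else [exists i in p.2, n + val i == k]).
exists u => //; case: p {u_lt} uP => S T /= uP.
congr (_, _); apply/setP => i; rewrite inE uP.
- rewrite ltn_ord; apply/exists_inP/idP => [[j jS /eqP/val_inj <-] //|iS].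
  by exists i.
- by apply: (leq_trans (ltn_ord i)); lia.
- rewrite ltnNge leq_addr /=; apply/exists_inP/idP => [[j jT]|iT].
    by rewrite eqn_add2l => /eqP/val_inj <-.
  by exists i.
- by rewrite ltn_add2l.
Qed.

Lemma mask_separatingE n u : mask_separating n u = separating (mask_pair n u).
Proof.
rewrite /mask_separating /separating -andbA; congr [&& _, _ & _].
- apply/has_iotaP/finset.set0Pn => [[i lt_in ui]|[i]]; last by rewrite inE; exists i.
  by exists (Ordinal lt_in); rewrite inE.
- apply/has_iotaP/finset.set0Pn => [[i lt_in ui]|[i]]; last by rewrite inE; exists i.
  by exists (Ordinal lt_in); rewrite inE.
- rewrite disjoint_subset; apply/all_iotaP/fintype.subsetP => [h i|h i lt_in].
    by rewrite !inE => ui; apply: (implyP (h i _)).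
  by apply/implyP => ui; have := h (Ordinal lt_in); rewrite !inE => /(_ ui).
Qed.

Lemma entry_nonzeroE n (A : 'M[rat]_n) (i j : 'I_n) :
  entry_nonzero (code_mx A) i j = (A i j != 0%R).
Proof.
rewrite /entry_nonzero /code_mx CodeSeq.codeK (nth_map i) ?size_enum_ord //.
rewrite nth_ord_enum CodeSeq.codeK (nth_map j) ?size_enum_ord // nth_ord_enum.
by rewrite CodeSeq.codeK /= absz_eq0 numq_eq0.
Qed.

Lemma mask_supportedE n (A : 'M[rat]_n) u v :
  mask_supported n (code_mx A) u v =
  supported A (mask_pair n u).1 (mask_pair n v).1 &&
  supported A (mask_pair n u).2 (mask_pair n v).2.
Proof.
apply/all_iotaP/andP => [h|[/supportedP h1 /supportedP h2] i lt_in].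
  split; apply/supportedP => i j; rewrite !inE => ui Aij;
    have /all_iotaP/(_ j (ltn_ord j)) := h i (ltn_ord i);
    by rewrite entry_nonzeroE Aij ui => /andP[].
apply/all_iotaP => j lt_jn; apply/implyP.
rewrite (entry_nonzeroE A (Ordinal lt_in) (Ordinal lt_jn)) => Aij.
have := h1 _ _ _ Aij; have := h2 _ _ _ Aij; rewrite !inE /= => g2 g1.
by apply/andP; split; apply/implyP.
Qed.

Lemma mask_escapesP n (l : seq 'M[rat]_n) w u :
  reflect (exists v A, [/\ v < 2 ^ (n + n), bit w v, A \in l,
      supported A (mask_pair n u).1 (mask_pair n v).1 &
      supported A (mask_pair n u).2 (mask_pair n v).2])
    (mask_escapes n (CodeSeq.code [seq code_mx A | A <- l]) w u).
Proof.
rewrite /mask_escapes; set L := CodeSeq.code _.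
have decL : CodeSeq.decode L = [seq code_mx A | A <- l] by rewrite CodeSeq.codeK.
apply: (iffP (has_iotaP _ _)) => [[v v_lt /andP[wv /has_iotaP[m _]]]|].
  rewrite decL size_map => /andP[lt_m]; rewrite (nth_map 0%R) // mask_supportedE.
  by move=> /andP[s1 s2]; exists v, (nth 0%R l m); rewrite mem_nth.
move=> [v [A [v_lt wv Al s1 s2]]]; exists v => //; rewrite wv /=.
have lt_m : index A l < size l by rewrite index_mem.
apply/has_iotaP; exists (index A l).
  by apply: leq_trans lt_m _; rewrite -(size_map (@code_mx n)); exact: size_code.
by rewrite decL size_map lt_m /= (nth_map 0%R) // nth_index // mask_supportedE s1 s2.
Qed.

(** Every pair has a mask and every family of masks is the set of bits of some
number below the search bound; conversely the masks selected by [w] describe a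
trap, even if several of them describe the same pair. *)
Lemma has_trapP n (l : seq 'M[rat]_n) :
  has_trap n (CodeSeq.code [seq code_mx A | A <- l]) <->
  exists W, trap [set` l] W.
Proof.
split=> [/has_iotaP[w _ /andP[/has_iotaP[u0 u0_lt wu0] /all_iotaP wP]]|[W [W0 WP]]].
  exists [set p | has (fun u => bit w u && (mask_pair n u == p))
                      (iota 0 (2 ^ (n + n)))]%SET; split.
    apply/finset.set0Pn; exists (mask_pair n u0); rewrite inE.
    by apply/has_iotaP; exists u0; rewrite ?wu0 ?eqxx.
  move=> _ /[!inE] /has_iotaP[u u_lt /andP[wu /eqP <-]].
  have /andP[sep /mask_escapesP[v [A [v_lt wv Al s1 s2]]]] := implyP (wP u u_lt) wu.
  rewrite -mask_separatingE; split=> //; exists A, (mask_pair n v).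
  split=> //; rewrite inE; apply/has_iotaP; exists v => //.
  by rewrite wv eqxx.
have [w w_lt wP] := mask_exists (2 ^ (n + n)) (fun u => mask_pair n u \in W).
apply/has_iotaP; exists w => //; apply/andP; split.
  have /finset.set0Pn[p pW] := W0; have [u u_lt up] := mask_pair_surj p.
  by apply/has_iotaP; exists u; rewrite ?wP // up.
apply/all_iotaP => u u_lt; rewrite wP //; apply/implyP => /WP[sep].
move=> [A [q [/= Al qW s1 s2]]]; rewrite mask_separatingE sep /=.
have [v v_lt vq] := mask_pair_surj q; rewrite -vq in qW s1 s2.
by apply/mask_escapesP; exists v, A; rewrite wP.
Qed.

(** * Decidability *)

Local Open Scope ring_scope.

Lemma instance_set_stochastic (R : realType) (I : instance) (A : 'M[R]_(tag I)) :
  stochastic_instance I -> @instance_set R I A -> stochastic A.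
Proof.
move=> stI [B BI <-]; have [B0 B1] := stI _ BI; split=> [i j|i].
  by rewrite mxE ler0q.
by under eq_bigr do rewrite mxE; rewrite -rmorph_sum B1 rmorph1.
Qed.

(** Traps depend only on the positions of the nonzero entries, so the reals can be
left out of the decision. *)
Lemma trap_instance_set (R : realType) (I : instance) W :
  trap (@instance_set R I) W <-> trap [set` tagged I] W.
Proof.
have suppE (A : 'M[rat]_(tag I)) S T :
    supported (map_mx ratr A : 'M[R]_(tag I)) S T = supported A S T.
  apply/supportedP/supportedP => h i j iS Aij; apply: (h i) => //.
    by rewrite mxE fmorph_eq0.
  by rewrite mxE fmorph_eq0 in Aij.
split=> -[W0 WP]; split=> // p /WP[sep].
  move=> [_ [q [[A AI <-] qW]]]; rewrite !suppE => s1 s2; split=> //.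
  by exists A, q.
move=> [A [q [AI qW s1 s2]]]; split=> //.
by exists (map_mx ratr A), q; rewrite !suppE; split=> //; exists A.
Qed.

Lemma pos_lower_bound (R : realDomainType) (s : seq R) :
  exists2 e, 0 < e & forall x, x \in s -> 0 < x -> e <= x.
Proof.
elim: s => [|y s [e e0 es]]; first by exists 1.
have [y0|y_le0] := ltP 0 y; last first.
  by exists e => // x /[!inE] /orP[/eqP ->|/es //]; rewrite ltNge y_le0.
exists (Num.min y e) => [|x /[!inE] /orP[/eqP ->|/es h x0]].
- by rewrite lt_min y0.
- by rewrite ge_min lexx.
- by rewrite ge_min h ?orbT.
Qed.

Lemma consensus_instanceE (R : realType) (I : instance) :
  stochastic_instance I ->
  consensus_set (@instance_set R I) <-> ~ exists W, trap [set` tagged I] W.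
Proof.
move=> stI; have stR A := @instance_set_stochastic R I A stI.
split=> [cons [W /(trap_instance_set R) tW]|notrap].
  exact: trap_not_consensus tW cons.
have [e e0 eP] := pos_lower_bound
  [seq ratr (fun_of_matrix B p.1 p.2) : R | B <- tagged I, p <- enum {: 'I_(tag I) * 'I_(tag I)}].
apply: consensus_of_no_trap e0 _ _ => // [A i j PsA Aij|W /trap_instance_set tW].
  have [A0 _] := stR _ PsA; apply: eP; last by rewrite lt0r Aij A0.
  case: PsA => B BI <-; rewrite mxE.
  by apply/allpairsP; exists (B, (i, j)); rewrite mem_enum.
by apply: notrap; exists W.
Qed.

Theorem proposition2p6 (R : realType) :
  algorithmically_decidable code_instance stochastic_instance
    (fun I : instance => consensus_set (@instance_set R I)).
Proof.
have [p pP] := computable_neg computable_has_trap; exists p => I stI.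
exists (~~ has_trap (tag I) (CodeSeq.code [seq code_mx A | A <- tagged I])).
split; first by have := pP [tuple code_instance I]; rewrite /= CodeSeq.codeK.
rewrite consensus_instanceE // -has_trapP.
by split; [exact: negP | move/negP].
Qed.
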